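(* For every $n \ge 3$, the number $S_n$ of colourability sinks in $\{0,1\}^n$ satisfies $S_n = K_n - 4$, where $K_n$ is the number of non-colourable strings of length $n$.
   Context: Strings are over $\Lambda=\{0,1\}$; $\varepsilon$ is the empty string, $\#w$ the length of $w$. For $\#w\ge 1$ let $l(w)$ be $w$ with its last letter removed and $r(w)$ be $w$ with its first letter removed. Let $T^n$ be the alternating string of length $n$ starting with $0$ ($T^0=\varepsilon$, $T^n=T^{n-1}0$ for odd $n$, $T^n=T^{n-1}1$ for even $n\ge 2$) and $CT^n$ its letterwise complement. Define $\xi:\Lambda^*\to\{-1,0,1\}$ recursively: $\xi(\varepsilon)=0$; $\xi(w)=1$ if $w=T^k$ with $k\ge 2$ even; $\xi(w)=-1$ if $w=CT^k$ with $k\ge2$ even; otherwise $\xi(w)=\operatorname{sgn}(\xi(l(w))+\xi(r(w)))$. Define $\phi:\Lambda^*\to\{-1,0,1\}$: $\phi(\varepsilon)=0$; $\phi(w)=-1$ if $w=0^k$, $k$ odd; $\phi(w)=1$ if $w=1^k$, $k$ odd; otherwise $\phi(w)=\operatorname{sgn}(\phi(r(w))-\phi(l(w)))$. Let $\psi(w)=\xi(w)^{\#w}\phi(w)$ (with $0^0=1$); $w$ is colourable iff $\psi(w)\ne0$. $K_n=\#\{w\in\Lambda^n:\psi(w)=0\}$. A string $w$ is a colourability sink if neither $w0$ nor $w1$ is colourable, and a colourability source if neither $0w$ nor $1w$ is colourable. *)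

(* Defs.v *)
From mathcomp Require Import all_boot all_order all_algebra.

Set Implicit Arguments.
Unset Strict Implicit.
Unset Printing Implicit Defensive.

Import GRing.Theory.

Local Open Scope ring_scope.

(* Strings over {0,1} are [seq bool], with 0 = false and 1 = true. *)
Definition string := seq bool.

(* l(w) and r(w); junk value [::] on the empty string, never used. *)
Definition lstr (w : string) : string := take (size w).-1 w.
Definition rstr (w : string) : string := behead w.

Fixpoint altT (n : nat) : string :=
  if n is m.+1 then rcons (altT m) (odd m) else [::].
Definition altCT (n : nat) : string := map negb (altT n).

(* xi and phi recurse on l(w) and r(w), which are not structural subterms of
   w, so the recursion is on k = size w.  The lemmas xi_nil, xi_altT,
   xi_altCT, xi_step and phi_nil, phi_nseq0, phi_nseq1, phi_step below recover
   the recursive definitions clause by clause. *)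
Fixpoint xi_rec (k : nat) (w : string) : int :=
  if k is k'.+1 then
    if ~~ odd k && (w == altT k) then 1
    else if ~~ odd k && (w == altCT k) then -1
    else Num.sg (xi_rec k' (lstr w) + xi_rec k' (rstr w))
  else 0.
Definition xi (w : string) : int := xi_rec (size w) w.

Fixpoint phi_rec (k : nat) (w : string) : int :=
  if k is k'.+1 then
    if odd k && (w == nseq k false) then -1
    else if odd k && (w == nseq k true) then 1
    else Num.sg (phi_rec k' (rstr w) - phi_rec k' (lstr w))
  else 0.
Definition phi (w : string) : int := phi_rec (size w) w.

Definition psi (w : string) : int := xi w ^+ size w * phi w.

Definition colourable (w : string) : bool := psi w != 0.

Definition colourability_sink (w : string) : bool :=
  ~~ colourable (rcons w false) && ~~ colourable (rcons w true).

Definition num_noncolourable (n : nat) : nat :=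
  #|[set w : n.-tuple bool | psi w == 0]|.

Definition num_sinks (n : nat) : nat :=
  #|[set w : n.-tuple bool | colourability_sink w]|.

Lemma size_lstr w : size (lstr w) = (size w).-1.
Proof. by rewrite size_takel // leq_pred. Qed.

Lemma size_rstr w : size (rstr w) = (size w).-1.
Proof. by rewrite size_behead. Qed.

Lemma size_altT n : size (altT n) = n.
Proof. by elim: n => //= n IHn; rewrite size_rcons IHn. Qed.

Lemma size_altCT n : size (altCT n) = n.
Proof. by rewrite size_map size_altT. Qed.

Lemma xi_nil : xi [::] = 0.
Proof. by []. Qed.

Lemma xi_altT k : (2 <= k)%N -> ~~ odd k -> xi (altT k) = 1.
Proof. by rewrite /xi size_altT; case: k => // k _ /= ->; rewrite eqxx. Qed.

Lemma xi_altCT k : (2 <= k)%N -> ~~ odd k -> xi (altCT k) = -1.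
Proof.
rewrite /xi size_altCT; case: k => // k _ ek.
rewrite -[RHS]/(- 1) /xi_rec -/xi_rec ek eqxx /=.
case: eqP => // /(congr1 (fun s => nth true s 0)).
have nthT m : nth true (altT m.+1) 0 = false.
  by elim: m => // m IHm; rewrite [altT _]/= nth_rcons -/(altT m.+1) size_altT IHm.
by rewrite nthT (nth_map true) ?size_altT // nthT.
Qed.

Lemma xi_step w : w != [::] ->
  (forall k, (2 <= k)%N -> ~~ odd k -> w <> altT k) ->
  (forall k, (2 <= k)%N -> ~~ odd k -> w <> altCT k) ->
  xi w = Num.sg (xi (lstr w) + xi (rstr w)).
Proof.
rewrite /xi size_lstr size_rstr -size_eq0 => nz hT hCT.
case ek: (size w) nz => [|k] // _; rewrite /xi_rec -/xi_rec.
have [ev|//] := boolP (~~ odd k.+1).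
have k2 : (2 <= k.+1)%N by case: k ek ev.
by rewrite !andTb; case: eqP => [/(hT _ k2 ev)//|_]; case: eqP => [/(hCT _ k2 ev)//|_].
Qed.

Lemma phi_nil : phi [::] = 0.
Proof. by []. Qed.

Lemma phi_nseq0 k : odd k -> phi (nseq k false) = -1.
Proof. by rewrite /phi size_nseq; case: k => // k ok; rewrite /phi_rec ok eqxx. Qed.

Lemma phi_nseq1 k : odd k -> phi (nseq k true) = 1.
Proof. by rewrite /phi size_nseq; case: k => // k ok; rewrite /phi_rec ok eqxx. Qed.

Lemma phi_step w : w != [::] ->
  (forall k, odd k -> w <> nseq k false) ->
  (forall k, odd k -> w <> nseq k true) ->
  phi w = Num.sg (phi (rstr w) - phi (lstr w)).
Proof.
rewrite /phi size_lstr size_rstr -size_eq0 => nz h0 h1.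
case ek: (size w) nz => [|k] // _; rewrite /phi_rec -/phi_rec.
have [ok|//] := boolP (odd k.+1).
by rewrite !andTb; case: eqP => [/(h0 _ ok)//|_]; case: eqP => [/(h1 _ ok)//|_].
Qed.

(* Main.v *)
(* Removing both end letters of a string at once makes the recursions explicit.
   Call w flat if it is constant, or alternating of odd length.  Then xi (a w b)
   is b - a when w is flat, and otherwise vanishes iff xi w does (it even equals
   xi w unless w is alternating of even length); similarly phi (a w b) = - phi w
   unless w is constant.  Hence psi and xi have the same zeros, and a w b is
   non-colourable iff w is flat and a = b, or w is a non-flat zero of psi.  Writing
   K, c, Z for the numbers of non-colourable, flat, and non-flat non-colourable
   strings, this gives S_(n+1) = 2 Z_n, K_(n+2) = 2 K_n + 2 Z_n and K_n = c_n + Z_n;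
   since c_n + c_(n+1) = 6 for n >= 2, the theorem follows by induction on n. *)

Require Import Defs.
From mathcomp Require Import all_boot all_order all_algebra.
From mathcomp Require Import zify.

Set Implicit Arguments.
Unset Strict Implicit.
Unset Printing Implicit Defensive.

Import GRing.Theory Num.Theory.

Local Open Scope ring_scope.

(** * Alternating strings *)

(** Unlike [altT], this grows from the front with a free first letter, so tails of alternating
    strings keep the same form. *)
Fixpoint alt (x : bool) (n : nat) : string :=
  if n is m.+1 then x :: alt (~~ x) m else [::].

Lemma size_alt x n : size (alt x n) = n.
Proof. by elim: n x => //= n IHn x; rewrite IHn. Qed.

Lemma altSr x n : alt x n.+1 = rcons (alt x n) (x (+) odd n).
Proof.
elim: n x => [|n IHn] x; first by rewrite /= addbF.
by rewrite -[LHS]/(x :: alt (~~ x) n.+1) IHn /=; case: x; case: (odd n).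
Qed.

Lemma altT_alt n : altT n = alt false n.
Proof. by elim: n => // n IHn; rewrite altSr -IHn. Qed.

Lemma altCT_alt n : altCT n = alt true n.
Proof.
rewrite /altCT altT_alt -[true]/(~~ false).
by elim: n false => //= n IHn x; rewrite IHn.
Qed.

Lemma rev_alt x n : rev (alt x n) = alt (x (+) ~~ odd n) n.
Proof.
elim: n x => // n IHn x; rewrite [RHS]altSr [alt x n.+1]/= rev_cons IHn.
by rewrite /=; case: x; case: (odd n).
Qed.

Lemma nseqSr (T : Type) k (c : T) : nseq k.+1 c = rcons (nseq k c) c.
Proof. by rewrite -addn1 nseqD cats1. Qed.

Lemma lstr_rcons w b : lstr (rcons w b) = w.
Proof. by rewrite /lstr size_rcons -cats1 take_size_cat. Qed.

(** * Stripping both end letters in [xi] *)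

Lemma xi_alt x k : (0 < k)%N -> ~~ odd k -> xi (alt x k) = 1 - x%:R *+ 2.
Proof.
case: k => [|[|k]] // _ ek; case: x.
  by rewrite -altCT_alt xi_altCT.
by rewrite -altT_alt xi_altT.
Qed.

(** The hypothesis says that [a :: rcons w b] is not alternating of even length, which excludes the
    base cases of [xi]. *)
Lemma xi_peel a w b :
  odd (size w) || (w != alt (~~ a) (size w)) || (b == a) ->
  xi (a :: rcons w b) = Num.sg (xi (a :: w) + xi (rcons w b)).
Proof.
move=> h; rewrite xi_step //.
- by rewrite -rcons_cons lstr_rcons.
all: move=> k k2 ek; rewrite ?altT_alt ?altCT_alt => E.
all: have sk := congr1 size E; rewrite /= size_rcons size_alt in sk.
all: move: E ek h; rewrite -{}sk {k k2} altSr [alt _ (size w).+1]/= negbK => -[->].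
all: move=> /rcons_inj [<- ->] /= /negbTE.
all: by rewrite -/(odd _) eqxx => ->.
Qed.

Lemma xi1 a : xi [:: a] = 0.
Proof. by case: a. Qed.

(** The two recursive values [c - a] and [b - c] telescope to [b - a], which is its own sign. *)
Lemma xi_peel_nseq k a b c : xi (a :: rcons (nseq k c) b) = b%:R - a%:R.
Proof.
elim: k a b => [|k IHk] a b; first by case: a; case: b.
case: k IHk => [|k] IHk; first by case: a; case: b; case: {IHk} c.
rewrite xi_peel; last first.
  by rewrite size_nseq /=; case: a; case: {IHk} c; rewrite ?orbT.
rewrite -[nseq k.+2 c]/(c :: nseq k.+1 c) rcons_cons IHk.
by rewrite -[c :: _]/(nseq k.+2 c) nseqSr IHk; case: a; case: b; case: {IHk} c.
Qed.

(** For even [k] the formula means [b - a] when [a] and [b] differ, and [xi (alt c k)], that is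
    [1 - 2c], when they agree. *)
Lemma xi_peel_alt k a b c : (0 < k)%N ->
  xi (a :: rcons (alt c k) b) =
    if odd k then b%:R - a%:R
    else Num.sg ((b%:R - a%:R) *+ 2 + (1 - c%:R *+ 2)).
Proof.
elim: k a b c => // k IHk a b c _.
case: k IHk => [|k] IHk; first by case: a; case: b; case: c.
(* Here the whole string is alternating of even length, so its value comes from a base case and not
   from the recursion. *)
have [/andP[ek /andP[/eqP Ea /eqP Eb]]|H] :=
    boolP (odd k.+1 && ((a == ~~ c) && (b == c))).
  have -> : a :: rcons (alt c k.+2) b = alt a k.+4.
    rewrite -[alt a k.+4]/(a :: alt (~~ a) k.+3) Ea negbK (altSr c k.+2).
    congr (_ :: rcons _ _).
    by move: Eb ek => /= ->; case: (odd k); case: (c).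
  rewrite xi_alt //; last by move: ek => /=; rewrite !negbK.
  by rewrite Ea Eb; move: ek => /= ->; case: (c).
rewrite xi_peel; last first.
  rewrite size_alt [alt c _]/= [alt (~~ a) _]/= eqseq_cons.
  by move: H => /=; case: (odd k); case: a; case: b; case: {IHk} c; rewrite ?orbT.
rewrite {1}altSr IHk //.
rewrite -[alt c k.+2]/(c :: alt (~~ c) k.+1) rcons_cons IHk //.
by move: H => /=; case: (odd k); case: a; case: b; case: c.
Qed.

Lemma string_ends (w : string) :
  [\/ w = [::], exists c, w = [:: c] | exists c u d, w = c :: rcons u d].
Proof.
case: w => [|c w]; first by constructor 1.
case/lastP: w => [|u d]; first by constructor 2; exists c.
by constructor 3; exists c, u, d.
Qed.

Definition alternating (w : string) : bool := w == alt (head false w) (size w).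

Lemma alternatingP w : reflect (exists c, w = alt c (size w)) (alternating w).
Proof.
apply: (iffP eqP) => [|[c]]; first by exists (head false w).
by case: w => //= d w [-> E]; rewrite -E.
Qed.

Lemma alternating_alt c k : alternating (alt c k).
Proof. by apply/alternatingP; exists c; rewrite size_alt. Qed.

Lemma constant_rev (w : string) : constant (rev w) = constant w.
Proof.
have H (v : string) : constant v -> constant (rev v).
  by case/(constantP false)=> c ->; rewrite rev_nseq constant_nseq.
by apply/idP/idP => /H //; rewrite revK.
Qed.

Lemma alternating_rev w : alternating (rev w) = alternating w.
Proof.
have H v : alternating v -> alternating (rev v).
  by case/alternatingP=> c ->; rewrite rev_alt alternating_alt.
by apply/idP/idP => /H //; rewrite revK.
Qed.

Lemma string_rev_ind (P : string -> Prop) :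
  P [::] -> (forall c, P [:: c]) ->
  (forall a w b, P (a :: w) -> P (rcons w b) -> P w -> P (a :: rcons w b)) ->
  forall w, P w.
Proof.
move=> P0 P1 PS w; have [n] := ubnP (size w); elim: n w => // n IHn w.
case: (string_ends w) => [->|[c ->]|[c [u [d ->]]]] //=.
rewrite size_rcons ltnS => lt_u_n.
by apply: PS; apply: IHn; rewrite ?size_rcons //= ltnW.
Qed.

(** Reversal swaps the two factors in the recursion and exchanges the two alternating strings of
    each even length. *)
Lemma xi_rev w : xi (rev w) = - xi w.
Proof.
elim/string_rev_ind: w => [|c|a w b IHl IHr _]; rewrite ?xi1 //.
have [H|] := boolP (odd (size w) || (w != alt (~~ a) (size w)) || (b == a)).
  rewrite xi_peel // rev_cons rev_rcons /= xi_peel.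
    by rewrite -rev_cons -rev_rcons IHl IHr -opprD sgrN addrC.
  rewrite size_rev; case/orP: H => [/orP[->//|H]|/eqP->]; last by rewrite eqxx orbT.
  case: eqP => [E|]; last by rewrite orbT.
  have [//|ev] := boolP (odd (size w)); case: (a =P b) => // nab.
  case/eqP: H; rewrite -[LHS]revK E rev_alt (negbTE ev) addbT negbK.
  by congr alt; move: nab; case: (a); case: (b).
rewrite !negb_or negbK => /andP[/andP[ev /eqP E] nab].
have -> : a :: rcons w b = alt a (size w).+2.
  rewrite -[RHS]/(a :: alt (~~ a) (size w).+1) altSr -E (negbTE ev).
  by move: nab; case: (a); case: (b).
rewrite rev_alt !xi_alt /= ?negbK // (negbTE ev).
by case: (a).
Qed.

Lemma xi_nseq k c : xi (nseq k c) = 0.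
Proof.
case: k => [|[|k]] //.
by rewrite nseqSr [nseq _ _]/= rcons_cons xi_peel_nseq subrr.
Qed.

Lemma xi_alt_odd k c : odd k -> xi (alt c k) = 0.
Proof.
case: k => [|[|k]] //.
rewrite /= negbK => ok; rewrite -[_ :: _]/(c :: alt (~~ c) k.+1) altSr.
rewrite xi_peel_alt ?ok; last by case: (k) ok.
by case: c.
Qed.

Lemma constant_rcons_nseq k (c d : bool) :
  constant (rcons (nseq k.+1 c) d) = (d == c).
Proof. by rewrite /= all_rcons all_pred1_nseq andbT. Qed.

Lemma alternating_rcons_alt k c d :
  alternating (rcons (alt c k.+1) d) = (d == c (+) odd k.+1).
Proof.
rewrite /alternating size_rcons size_alt -[head _ _]/c (altSr c k.+1).
by rewrite eqseq_rcons eqxx.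
Qed.

Lemma xi_peel_nalt a w b : ~~ alternating (a :: rcons w b) ->
  xi (a :: rcons w b) = Num.sg (xi (a :: w) + xi (rcons w b)).
Proof.
move=> nA; apply: xi_peel; apply: contraR nA.
rewrite !negb_or negbK => /andP[/andP[ev /eqP E] nab].
apply/alternatingP; exists a; rewrite /= size_rcons altSr -E (negbTE ev).
by move: nab; case: (a); case: (b).
Qed.

Lemma xi_peel_around a w b : ~~ alternating w ->
  xi (a :: rcons w b) = Num.sg (xi (a :: w) + xi (rcons w b)).
Proof.
move=> nA; apply: xi_peel; rewrite (_ : _ != _) ?orbT //.
by apply: contra nA => /eqP->; apply: alternating_alt.
Qed.

(* The values at [a :: rcons (c :: u) d] and at [c :: rcons (rcons u d) b] are
   never opposite here, so the outer letters [a] and [b] do not matter. *)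
Lemma xi_peel_prefix (a c : bool) (u : string) (d b : bool) :
  (forall (w : string) a b, (size w < (size u).+2)%N ->
     ~~ constant w -> ~~ alternating w -> xi (a :: rcons w b) = xi w) ->
  ~~ constant (c :: rcons u d) -> ~~ alternating (c :: rcons u d) ->
  constant (c :: u) || alternating (c :: u) ->
  xi (a :: rcons (c :: rcons u d) b) = xi (c :: rcons u d).
Proof.
move=> IH nC nA H.
rewrite (xi_peel_around _ _ nA) [in RHS]xi_peel_nalt //.
rewrite -[a :: c :: _]/(a :: rcons (c :: u) d) [rcons (c :: _) b]rcons_cons.
case/orP: H => [/(constantP false)[e]|/alternatingP[e]] => -[<-] {e}.
  move: (size u) IH => m IH Eu; subst u.
  have dc : d = ~~ c.
    move: nC; rewrite -rcons_cons -[c :: _]/(nseq m.+1 c) constant_rcons_nseq.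
    by case: (c); case: (d).
  subst d; case: m IH nC nA => [_ _|m IH _ _].
    by rewrite -[_ :: _]/(alt c 2) alternating_alt.
  rewrite -[c :: nseq _ _]/(nseq m.+2 c) xi_peel_nseq xi_nseq.
  have Xw : xi (rcons (nseq m.+1 c) (~~ c)) = (~~ c)%:R - c%:R.
    exact: (xi_peel_nseq m c (~~ c) c).
  (* The inner core is neither constant nor alternating, so induction applies, except for [m = 0],
     when it is [alt c 2]. *)
  have -> : xi (c :: rcons (rcons (nseq m.+1 c) (~~ c)) b) = (~~ c)%:R - c%:R.
    case: m IH Xw => [_ _|m IH Xw].
      by rewrite (@xi_peel_alt 2 c b c isT); case: (b); case: (c).
    rewrite IH //; first by rewrite size_rcons size_nseq.
    - by rewrite constant_rcons_nseq; case: (c).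
    - by rewrite /alternating /= !eqseq_cons; case: (c).
  by rewrite Xw; case: (a); case: (c).
move: (size u) IH => m IH Eu; subst u.
(* As the string is not alternating, [d] repeats the last letter of [alt c m.+1]. *)
have dc : d = c (+) odd m.
  move: nA; rewrite -rcons_cons -[c :: _]/(alt c m.+1) alternating_rcons_alt /=.
  by case: (c); case: (d); case: (odd m).
subst d; case: m IH nC nA => [_|m IH _ _].
  by rewrite /= addbF eqxx.
rewrite -[c :: alt _ _]/(alt c m.+2) xi_peel_alt //.
case: m IH => [|m] IH.
  have -> : rcons (alt (~~ c) 1) (c (+) odd 1) = nseq 2 (~~ c) by rewrite /= addbT.
  rewrite xi_peel_nseq xi_nseq xi_alt //.
  by case: a; case: b; case: (c).
rewrite IH.
- have [om|em] := boolP (odd m).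
    rewrite xi_alt /= ?om //.
    by case: (a); case: (c).
  have -> := @xi_peel_alt m.+1 (~~ c) (c (+) odd m.+2) (~~ ~~ c) isT.
  by rewrite xi_alt_odd /= (negbTE em) //; case: (a); case: (c).
- by rewrite size_rcons size_alt.
- by rewrite /=; case: (c).
- by rewrite alternating_rcons_alt; case: (c); case: (odd _).
Qed.

(** If [c :: u] and [rcons u d] are both irregular, induction strips each of them and the recursion
    reassembles [xi w]. Otherwise [xi_peel_prefix] or its mirror image applies. *)
Lemma xi_peel_irregular (w : string) a b :
  ~~ constant w -> ~~ alternating w -> xi (a :: rcons w b) = xi w.
Proof.
have [n] := ubnP (size w); elim: n w a b => // n IHn w a b.
case: (string_ends w) => [->|[c ->]|[c [u [d ->]]]] //.
rewrite [size _]/= size_rcons !ltnS => lt_u_n nC nA.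
have IH v x y : (size v < (size u).+2)%N -> ~~ constant v -> ~~ alternating v ->
    xi (x :: rcons v y) = xi v.
  by move=> lt_v; apply: IHn; apply: leq_trans lt_v _.
have [H|] := boolP (constant (c :: u) || alternating (c :: u)).
  exact: xi_peel_prefix.
rewrite negb_or => /andP[nCl nAl].
have [H|] := boolP (constant (rcons u d) || alternating (rcons u d)).
  (* By [xi_rev] both sides change sign and the suffix becomes a prefix. *)
  apply: oppr_inj; rewrite -!xi_rev rev_cons rev_rcons rcons_cons.
  rewrite !rev_cons !rev_rcons !rcons_cons.
  apply: xi_peel_prefix.
  - by rewrite size_rev.
  - by rewrite -rev_cons -rev_rcons constant_rev.
  - by rewrite -rev_cons -rev_rcons alternating_rev.
  - by rewrite -rev_rcons constant_rev alternating_rev.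
rewrite negb_or => /andP[nCr nAr].
rewrite (xi_peel_around _ _ nA).
rewrite -[a :: c :: _]/(a :: rcons (c :: u) d) [rcons (c :: _) b]rcons_cons.
by rewrite (IH (c :: u)) // (IH (rcons u d)) ?size_rcons // -xi_peel_nalt.
Qed.

(** * Stripping both end letters in [phi] *)

Lemma phi_nseq k c : odd k -> phi (nseq k c) = c%:R *+ 2 - 1.
Proof. by case: c => ok; rewrite ?phi_nseq1 ?phi_nseq0. Qed.

Lemma phi_peel (a : bool) (w : string) b :
  ~~ odd (size w) || ~~ constant (a :: rcons w b) ->
  phi (a :: rcons w b) = Num.sg (phi (rcons w b) - phi (a :: w)).
Proof.
move=> h; rewrite phi_step //.
- by rewrite -rcons_cons lstr_rcons.
all: move=> k ok E; have sk := congr1 size E; rewrite /= size_rcons size_nseq in sk.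
all: by move: h ok; rewrite E constant_nseq orbF -sk /= negbK => /negbTE->.
Qed.

(** For odd [k] the value is [- phi (nseq k c)], except when the whole string is constant and thus a
    base case. *)
Lemma phi_peel_nseq k a b c :
  phi (a :: rcons (nseq k c) b) =
    if odd k then (if (a == c) && (b == c) then c%:R *+ 2 - 1 else 1 - c%:R *+ 2)
    else b%:R - a%:R.
Proof.
elim: k a b => [|k IHk] a b; first by case: a; case: b.
have [/andP[ok /andP[/eqP -> /eqP ->]]|H] :=
    boolP (odd k.+1 && ((a == c) && (b == c))).
  by rewrite ok !eqxx -nseqSr -[c :: _]/(nseq k.+3 c) phi_nseq //= negbK.
rewrite phi_peel; last first.
  rewrite size_nseq -negb_and; apply: contra H => /andP[-> /=].
  by rewrite all_rcons => /and3P[/eqP-> /eqP-> _]; rewrite eqxx.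
rewrite {2}nseqSr [nseq k.+1 c]/= rcons_cons !IHk eqxx andTb.
by move: H => /=; case: (odd k); case: (a); case: (b); case: (c).
Qed.

(** Reversal swaps the two terms of the difference, whose lengths have the opposite parity; hence
    the sign alternates with the length. *)
Lemma phi_rev w : phi (rev w) = if odd (size w) then phi w else - phi w.
Proof.
elim/string_rev_ind: w => [|c|a w b IHl IHr _] //.
have [H|] := boolP (~~ odd (size w) || ~~ constant (a :: rcons w b)).
  rewrite (phi_peel H) rev_cons rev_rcons rcons_cons phi_peel; last first.
    by rewrite size_rev -rcons_cons -rev_rcons -rev_cons constant_rev.
  rewrite -rev_cons -rev_rcons IHl IHr /= !size_rcons /=.
  case: (odd (size w)) => /=; last by rewrite -sgrN opprB.
  by rewrite opprK addrC.
rewrite negb_or !negbK => /andP[ow /(constantP false)[c ->]].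
by rewrite rev_nseq size_nseq /= size_rcons /= negbK ow.
Qed.

Lemma phi_peel_around (a b : bool) (w : string) : ~~ constant w ->
  phi (a :: rcons w b) = Num.sg (phi (rcons w b) - phi (a :: w)).
Proof.
move=> nC; apply: phi_peel; apply/orP; right; apply: contra nC => /=.
rewrite all_rcons => /andP[_ /all_pred1P->]; exact: constant_nseq.
Qed.

Lemma phi_peel_prefix (a c : bool) (u : string) (d b : bool) :
  (forall (w : string) a b, (size w < (size u).+2)%N -> ~~ constant w ->
     phi (a :: rcons w b) = - phi w) ->
  ~~ constant (c :: rcons u d) -> constant (c :: u) ->
  phi (a :: rcons (c :: rcons u d) b) = - phi (c :: rcons u d).
Proof.
move=> IH nC /(constantP false)[e] -[<-] {e}.
rewrite (phi_peel_around _ _ nC) phi_peel; last by rewrite nC orbT.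
rewrite -[a :: c :: _]/(a :: rcons (c :: u) d) [rcons (c :: _) b]rcons_cons.
move: (size u) IH => m IH Eu; subst u.
have dc : d = ~~ c.
  move: nC; rewrite -rcons_cons -[c :: _]/(nseq m.+1 c) constant_rcons_nseq.
  by case: (c); case: (d).
subst d; rewrite -[c :: nseq _ _]/(nseq m.+1 c) phi_peel_nseq.
have -> : phi (c :: rcons (rcons (nseq m c) (~~ c)) b) =
    - phi (rcons (nseq m c) (~~ c)).
  case: m IH {nC} => [|m] IH; first by case: (b); case: (c).
  by rewrite IH ?size_rcons ?size_nseq // constant_rcons_nseq; case: (c).
(* For odd [m.+1] stripping negates both terms of the difference; for even [m.+1] the result is
   [c - ~~ c], whatever [a] is. *)
have [om|em] := boolP (odd m.+1).
  by rewrite phi_nseq //= -sgrN opprB addrC; case: (a); case: (c).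
case: m em {IH nC} => // m em.
have -> := phi_peel_nseq m c (~~ c) c.
rewrite nseqSr [nseq m.+1 c]/= rcons_cons phi_peel_nseq.
by move: em => /=; rewrite negbK => /negbTE->; case: (a); case: (c).
Qed.

(** Same induction as for [xi]; only constant factors are exceptional, since the base cases of [phi]
    are constant. *)
Lemma phi_peel_irregular (w : string) a b :
  ~~ constant w -> phi (a :: rcons w b) = - phi w.
Proof.
have [n] := ubnP (size w); elim: n w a b => // n IHn w a b.
case: (string_ends w) => [->|[c ->]|[c [u [d ->]]]] //.
rewrite [size _]/= size_rcons !ltnS => lt_u_n nC.
have IH (v : string) x y : (size v < (size u).+2)%N -> ~~ constant v ->
    phi (x :: rcons v y) = - phi v.
  by move=> lt_v; apply: IHn; apply: leq_trans lt_v _.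
have [H|nCl] := boolP (constant (c :: u)); first exact: phi_peel_prefix.
have [H|nCr] := boolP (constant (rcons u d)).
  (* The suffix case is the prefix case reversed; [w] and [a :: rcons w b] have lengths of equal
     parity, so [phi_rev] gives them the same sign. *)
  have E := phi_rev (a :: rcons (c :: rcons u d) b).
  have := @phi_peel_prefix b d (rev u) c a; rewrite size_rev => /(_ IH).
  have <- : rev (c :: rcons u d) = d :: rcons (rev u) c by rewrite rev_cons rev_rcons.
  have <- : rev (a :: rcons (c :: rcons u d) b) = b :: rcons (rev (c :: rcons u d)) a.
    by rewrite rev_cons rev_rcons.
  rewrite -rev_rcons !constant_rev => /(_ nC H); rewrite !phi_rev /= !size_rcons /=.
  by rewrite negbK; case: (odd (size u)) => // /oppr_inj.
rewrite (phi_peel_around _ _ nC).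
rewrite -[a :: c :: _]/(a :: rcons (c :: u) d) [rcons (c :: _) b]rcons_cons.
rewrite (IH (c :: u)) // (IH (rcons u d)) ?size_rcons //.
by rewrite -opprD sgrN -phi_peel // nC orbT.
Qed.

(** * Common zeros of [xi] and [psi] *)

Definition flat (w : string) : bool :=
  constant w || odd (size w) && alternating w.

Lemma xi_flat w : flat w -> xi w = 0.
Proof.
case/orP=> [/(constantP false)[c ->]|/andP[ow /alternatingP[c E]]].
  exact: xi_nseq.
by rewrite E xi_alt_odd.
Qed.

(** The only non-flat cores outside [xi_peel_irregular] are alternating of positive even length;
    there neither side vanishes. *)
Lemma xi_peel_eq0 a w b :
  (xi (a :: rcons w b) == 0) = if flat w then a == b else xi w == 0.
Proof.
rewrite /flat; have [/(constantP false)[c ->]|nC] := boolP (constant w).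
  by rewrite xi_peel_nseq; case: a; case: b.
have [/alternatingP[c E]|nA] := boolP (alternating w); last first.
  by rewrite xi_peel_irregular // andbF.
have sw : (0 < size w)%N by case: (w) nC.
rewrite E size_alt xi_peel_alt //; case: ifP => ow; first by case: a; case: b.
by rewrite xi_alt ?ow //; case: a; case: b; case: (c).
Qed.

(** Stripping preserves parity. For a constant core of even length both functions vanish exactly
    when [a] equals [b]; other cores of even length are not flat and pass their zeros on. At odd
    length [phi] stays nonzero. *)
Lemma phi_eq0 w : (phi w == 0) = ~~ odd (size w) && (xi w == 0).
Proof.
elim/string_rev_ind: w => [|[]|a w b _ _ IH] //.
rewrite xi_peel_eq0 /flat /= size_rcons /= negbK.
have [/(constantP false)[c ->]|nC] := boolP (constant w).
  by rewrite phi_peel_nseq size_nseq; case: (odd _); case: a; case: b; case: c.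
by rewrite phi_peel_irregular // oppr_eq0 IH /=; case: (odd _).
Qed.

(** A zero of [phi] is a zero of [xi]; conversely [xi w = 0] kills the power unless [w] is empty,
    where [phi] vanishes instead. *)
Lemma psi_eq0 w : (psi w == 0) = (xi w == 0).
Proof.
rewrite /psi mulf_eq0 expf_eq0 phi_eq0.
case: w => // a w; rewrite ltn0Sn /=; case: (_ == 0) => //.
by rewrite andbF.
Qed.

(** A flat [w] always leaves one colourable extension, the one whose last letter differs from
    [a]. *)
Lemma sink_cons a w : colourability_sink (a :: w) = (psi w == 0) && ~~ flat w.
Proof.
rewrite /colourability_sink /colourable !negbK !psi_eq0 !xi_peel_eq0.
by case: ifP => _; [case: a|]; rewrite ?andbF ?andbT ?andbb.
Qed.

(** * Counting strings by their end letters *)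

Implicit Type P : pred string.

Definition card_strings n P : nat := #|[set w : n.-tuple bool | P w]|.

Lemma eq_card_strings n P1 P2 :
  (forall w, size w = n -> P1 w = P2 w) -> card_strings n P1 = card_strings n P2.
Proof. by move=> eqP; apply: eq_card => w; rewrite !inE eqP ?size_tuple. Qed.

Lemma card_strings0 P : card_strings 0 P = P [::].
Proof.
rewrite /card_strings; case: (boolP (P [::])) => H.
  rewrite (_ : [set _ | _] = [set [tuple]]) ?cards1 //.
  by apply/setP=> w; rewrite !inE tuple0 eqxx.
by apply/eqP; rewrite cards_eq0; apply/eqP/setP=> w; rewrite !inE tuple0 (negbTE H).
Qed.

Lemma card_stringsS n P :
  card_strings n.+1 P =
  (card_strings n (fun w => P (false :: w)) +
   card_strings n (fun w => P (true :: w)))%N.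
Proof.
have inj a : injective (fun w : n.-tuple bool => [tuple of a :: w]).
  by move=> u v /(congr1 val) [] /val_inj.
have -> : card_strings n.+1 P =
    #|[set [tuple of false :: w] | w : n.-tuple bool in
         [set w : n.-tuple bool | P (false :: w)]]
      :|: [set [tuple of true :: w] | w : n.-tuple bool in
             [set w : n.-tuple bool | P (true :: w)]]|.
  apply: eq_card => w; rewrite !inE; apply/idP/idP.
    case/tupleP: w => -[] w Pw; apply/orP; [right|left];
      by apply/imsetP; exists w; rewrite ?inE.
  by case/orP => /imsetP[v]; rewrite inE => Pv ->.
rewrite cardsU !card_imset //= (_ : _ :&: _ = set0) ?cards0 ?subn0 //.
apply/setP=> w; rewrite !inE; apply/negP=> /andP[/imsetP[u _ ->] /imsetP[v _]].
by move/(congr1 val).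
Qed.

Lemma card_stringsSr n P :
  card_strings n.+1 P =
  (card_strings n (fun w => P (rcons w false)) +
   card_strings n (fun w => P (rcons w true)))%N.
Proof.
elim: n P => [|n IHn] P; first by rewrite card_stringsS !card_strings0.
rewrite card_stringsS (card_stringsS n (fun w => P (rcons w false))).
by rewrite (card_stringsS n (fun w => P (rcons w true))) !IHn addnACA.
Qed.

Lemma card_stringsID n P Q :
  card_strings n P =
  (card_strings n (fun w => P w && Q w) + card_strings n (fun w => P w && ~~ Q w))%N.
Proof.
rewrite /card_strings -(cardsID [set w : n.-tuple bool | Q w]).
by congr addn; apply: eq_card => w; rewrite !inE // andbC.
Qed.

Lemma card_strings_pred0 n : card_strings n pred0 = 0%N.
Proof. by apply/eqP; rewrite cards_eq0; apply/eqP/setP=> w; rewrite !inE. Qed.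

Lemma card_strings1 n s : size s = n -> card_strings n (pred1 s) = 1%N.
Proof.
move=> <-; rewrite /card_strings -(cards1 (in_tuple s)).
by apply: eq_card => w; rewrite !inE.
Qed.

(** * Flat strings and the recurrences *)

Lemma flat_cons a w : flat (a :: w) =
  (w == nseq (size w) a) || ~~ odd (size w) && (w == alt (~~ a) (size w)).
Proof.
rewrite /flat /= /alternating /= eqseq_cons eqxx /=; congr (_ || _).
exact/all_pred1P/eqP.
Qed.

(** The bound on [n] keeps constant and alternating strings distinct; at length 1 they coincide. *)
Lemma card_flat n : (1 < n)%N -> card_strings n flat = (if odd n then 4 else 2)%N.
Proof.
case: n => [|[|n]] // _; rewrite card_stringsS.
have H a : card_strings n.+1 (fun w => flat (a :: w)) = (if odd n then 2 else 1)%N.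
  rewrite (card_stringsID _ _ (pred1 (nseq n.+1 a))).
  rewrite (@eq_card_strings _ _ (pred1 (nseq n.+1 a))); last first.
    by move=> w sw; rewrite flat_cons sw /=; case: eqP; rewrite ?andbF.
  rewrite card_strings1 ?size_nseq //; case: ifP => on.
    rewrite (@eq_card_strings _ _ (pred1 (alt (~~ a) n.+1))).
      by rewrite card_strings1 ?size_alt.
    move=> w sw; rewrite flat_cons sw [odd _]/= on !inE.
    case: (w =P nseq _ _) => [->|_]; last by rewrite andbT.
    by rewrite /= eqseq_cons; case: (a).
  rewrite (@eq_card_strings _ _ pred0) ?card_strings_pred0 // => w sw.
  by rewrite flat_cons sw [odd _]/= on !inE orbF andbN.
by rewrite !H /= negbK; case: (odd n).
Qed.

Definition nonflat_zero (w : string) : bool := (psi w == 0) && ~~ flat w.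

Lemma num_noncolourable_split n :
  num_noncolourable n = (card_strings n flat + card_strings n nonflat_zero)%N.
Proof.
rewrite -[LHS]/(card_strings n (fun w => psi w == 0)) (card_stringsID _ _ flat).
congr addn; apply: eq_card_strings => w _.
by case: (boolP (flat w)) => [/xi_flat|]; rewrite ?andbF // andbT psi_eq0 => ->.
Qed.

Lemma num_sinksS n : num_sinks n.+1 = (card_strings n nonflat_zero).*2.
Proof.
rewrite -[LHS]/(card_strings n.+1 colourability_sink) card_stringsS -addnn.
by congr addn; apply: eq_card_strings => w _; rewrite sink_cons.
Qed.

(** Equal end letters allow every non-colourable core, distinct ones only a non-flat one; each case
    has two choices of ends. *)
Lemma num_noncolourableSS n : num_noncolourable n.+2 =
  (num_noncolourable n + card_strings n nonflat_zero).*2.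
Proof.
rewrite -[LHS]/(card_strings n.+2 (fun w => psi w == 0)).
rewrite card_stringsS !card_stringsSr.
have H a b : card_strings n (fun w => psi (a :: rcons w b) == 0) =
    if a == b then num_noncolourable n else card_strings n nonflat_zero.
  rewrite -[num_noncolourable n]/(card_strings n (fun w => psi w == 0)).
  case: ifP => ab; apply: eq_card_strings => w _;
    rewrite psi_eq0 xi_peel_eq0 ab /nonflat_zero psi_eq0.
  - by case: ifP => // /xi_flat->.
  - by case: ifP; rewrite ?andbF ?andbT.
by rewrite !H /= [X in (_ + X)%N]addnC addnn.
Qed.

Theorem theorem7p11 (n : nat) (hn : (3 <= n)%N) :
  (num_sinks n)%:Z = (num_noncolourable n)%:Z - 4.
Proof.
suff H p : (1 < p)%N -> (num_sinks p.+1 + 4)%N = num_noncolourable p.+1.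
  by case: n hn => // n hn; rewrite -H // PoszD addrK.
elim: p => // p IHp; rewrite ltnS leq_eqVlt => /orP[/eqP <-|p1].
  (* Lengths 0 and 1 fall outside [card_flat]. Direct values show that there is no non-flat zero up
     to length 2, hence no sink and four non-colourable strings at length 3. *)
  have c0 : card_strings 0 flat = 1%N by rewrite card_strings0.
  have c1 : card_strings 1 flat = 2%N by rewrite card_stringsS !card_strings0.
  have K0 : num_noncolourable 0 = 1%N by exact: card_strings0 (fun w => psi w == 0).
  have K1 : num_noncolourable 1 = 2%N.
    rewrite -[LHS]/(card_strings 1 (fun w => psi w == 0)) card_stringsS !card_strings0.
    by rewrite !psi_eq0 !xi1.
  have := num_noncolourable_split 0; have := num_noncolourable_split 1.
  have := num_noncolourable_split 2; rewrite card_flat // c0 c1 K0 K1.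
  by rewrite num_sinksS !num_noncolourableSS K0 K1 /=; lia.
have := IHp p1; rewrite !num_sinksS num_noncolourableSS !num_noncolourable_split.
rewrite (card_flat p1) (card_flat (leqW p1)) [odd p.+1]/=.
(* The parity of [p] only decides which of the two flat counts is 4 and which is 2; the rest is
   linear in [z] and [z']. *)
move: (card_strings p _) (card_strings p.+1 _) => z z'.
by case: (odd p) => /=; lia.
Qed.
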